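(* Let $n\ge 2$ and let $K$ and $L$ be two star bodies in $\mathbb{R}^n$ such that for every $\xi\in S^{n-1}$ there exists a rotation $\varphi_\xi\in SO(n-1,\xi^\perp)$ such that $$\varphi_\xi(K\cap\xi^\perp)\subseteq L\cap\xi^\perp.$$ Then $\mathrm{vol}_n(K)\le \mathrm{vol}_n(L)$.
   Context: A body in $\mathbb{R}^n$ is a compact set which is equal to the closure of its non-empty interior. A set $E$ is star-shaped at a point $p$ if the line segment from $p$ to any point of $E$ is contained in $E$. The radial function of a set $K$ that is star-shaped at the origin is $\rho_K(x)=\max\{c: cx\in K\}$ for $x\in\mathbb{R}^n\setminus\{0\}$. A star body is a body that is star-shaped at the origin and whose radial function is continuous. For $\xi\in S^{n-1}$, $\xi^\perp=\{x\in\mathbb{R}^n: x\cdot\xi=0\}$, and $SO(n-1,\xi^\perp)$ is the group of rotations of the hyperplane $\xi^\perp$ around the origin (equivalently, restrictions to $\xi^\perp$ of rotations $\Phi\in SO(n)$ with $\Phi(\xi)=\xi$). $\mathrm{vol}_n$ is $n$-dimensional Lebesgue measure. *)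

(* Defs.v *)
(* R^n is 'rV[R]_n, whose library topology is the product topology. *)
From HB Require Import structures.
From mathcomp Require Import all_boot all_order all_algebra.
From mathcomp Require Import all_classical all_reals all_analysis.

Set Implicit Arguments.
Unset Strict Implicit.
Unset Printing Implicit Defensive.

Import Order.TTheory GRing.Theory Num.Theory.
Import numFieldNormedType.Exports.

Local Open Scope classical_set_scope.
Local Open Scope ring_scope.

Definition dotmul (R : realType) (n : nat) (u v : 'rV[R]_n) : R :=
  \sum_(i < n) u 0 i * v 0 i.

Definition unit_sphere (R : realType) (n : nat) : set 'rV[R]_n :=
  [set xi | Num.sqrt (dotmul xi xi) = 1].

Definition perp (R : realType) (n : nat) (xi : 'rV[R]_n) : set 'rV[R]_n :=
  [set x | dotmul x xi = 0].

Definition is_body (R : realType) (n : nat) (K : set 'rV[R]_n) : Prop :=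
  [/\ compact K, interior K !=set0 & K = closure (interior K)].

Definition star_shaped_at (R : realType) (n : nat) (E : set 'rV[R]_n)
    (p : 'rV[R]_n) : Prop :=
  forall x (t : R), E x -> 0 <= t <= 1 -> E ((1 - t) *: p + t *: x).

(* For x != 0 and K nonempty, compact and star-shaped at 0, the set below is
   nonempty and compact, so its supremum is a maximum. *)
Definition radial_function (R : realType) (n : nat) (K : set 'rV[R]_n)
    (x : 'rV[R]_n) : R :=
  sup [set c : R | K (c *: x)].

Definition star_body (R : realType) (n : nat) (K : set 'rV[R]_n) : Prop :=
  [/\ is_body K, star_shaped_at K 0 &
      {within [set x : 'rV[R]_n | x != 0], continuous (radial_function K)}].

Definition SO (R : realType) (n : nat) : set 'M[R]_n :=
  [set Phi | Phi *m Phi^T = 1%:M /\ \det Phi = 1].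

(* Rotations of perp xi, represented by the elements of SO(n) that fix xi;
   matrices act on row vectors by x |-> x *m Phi. *)
Definition SO_perp (R : realType) (n : nat) (xi : 'rV[R]_n) : set 'M[R]_n :=
  [set Phi | SO Phi /\ xi *m Phi = xi].

(* n-fold product of the one-dimensional Lebesgue measure. *)
Fixpoint lebesgue_measure_tuple (R : realType) (n : nat) :
    set (n.-tuple (measurableTypeR R)) -> \bar R :=
  match n with
  | 0 => dirac [tuple]
  | m.+1 => pushforward
      (product_measure1 (@lebesgue_measure R) (@lebesgue_measure_tuple R m))
      (fun p => [tuple of p.1 :: p.2])
  end.

Definition vol (R : realType) (n : nat) (A : set 'rV[R]_n) : \bar R :=
  lebesgue_measure_tuple
    [set s : n.-tuple (measurableTypeR R) | A (\row_(i < n) tnth s i)].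

(* Main.v *)
Require Import Defs.
From HB Require Import structures.
From mathcomp Require Import all_boot all_order all_algebra.
From mathcomp Require Import all_classical all_reals all_analysis.
From mathcomp Require Import measurable_realfun lra ring.

(* For e > 0, let the slab of xi consist of the x with <xi, x>^2 < e |xi|^2 |x|^2,
   a relation symmetric in xi and x.  Since rho_K is uniformly continuous on the
   sphere, for e small every x in K and in the slab of xi is within d of a point
   of K cap xi^perp; the rotation attached to xi preserves both the slab and
   Lebesgue measure, so it embeds K cap slab into (d-neighbourhood of L) cap slab.
   Integrating over xi in the unit ball and exchanging the integrals multiplies
   each volume by the measure C of {xi in the ball : xi in the slab of x}.  By
   orthogonal invariance C does not depend on x <> 0, and C > 0 because n >= 2;
   hence vol K <= vol (d-neighbourhood of L), and d -> 0. *)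

Set Implicit Arguments.
Unset Strict Implicit.
Unset Printing Implicit Defensive.

Import Order.TTheory GRing.Theory Num.Theory.
Import numFieldNormedType.Exports.

Local Open Scope classical_set_scope.
Local Open Scope ring_scope.

(** * Lebesgue measure on tuples *)

(** By uniqueness of Lebesgue measure it suffices to compare the two measures on half-open
    intervals. *)
Lemma lebesgue_measureD (R : realType) (a : R) (A : set R) : measurable A ->
  pushforward lebesgue_measure ((fun x => x + a) : _ -> measurableTypeR R) A =
  lebesgue_measure A.
Proof.
move=> mA; apply/esym/lebesgue_measure_unique => //=.
  exact: measurable_funD.
move=> ? _ [[b c]] _ <-; rewrite /pushforward/=.
have -> : (fun x => x + a) @^-1` `]b, c] = `]b - a, c - a]%classic.
  by apply/seteqP; split=> x /=; rewrite !in_itv/= ltrBlDr lerBrDr.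
rewrite !lebesgue_measure_itv/= !lte_fin ltrD2r.
by case: ifP => // _; rewrite -!EFinD; congr EFin; ring.
Qed.

Section sigma_finite_measure_of.
Context d (T : measurableType d) (R : realType) (M : {measure set T -> \bar R}).
Context (sfM : sigma_finite setT M).

(** The proof of sigma-finiteness is an argument of this alias of [M], so that the instance below
    can recover it from the term. *)
Definition sigma_finite_measure_of (_ : sigma_finite setT M) : set T -> \bar R := M.

HB.instance Definition _ := Measure.on (sigma_finite_measure_of sfM).
HB.instance Definition _ :=
  Measure_isSigmaFinite.Build _ _ _ (sigma_finite_measure_of sfM) sfM.

End sigma_finite_measure_of.

Lemma sigma_finite_pushforward d1 d2 (T1 : measurableType d1)
    (T2 : measurableType d2) (R : realType) (m : {measure set T1 -> \bar R})
    (f : T1 -> T2) (F : (set T2)^nat) :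
  measurable_fun setT f -> (forall k, measurable (F k)) ->
  setT = \bigcup_k F k -> (forall k, m (f @^-1` F k) < +oo)%E ->
  exists m' : {sigma_finite_measure set T2 -> \bar R},
    m' = pushforward m f :> (set T2 -> \bar R).
Proof.
move=> mf mF FT Foo.
have [M ME] : exists M : {measure set T2 -> \bar R}, M = pushforward m f :> (_ -> _).
  by unshelve eexists (pushforward m f).
have sfM : sigma_finite setT M.
  by exists F => // k; split => //; rewrite ME; exact: Foo.
by exists (sigma_finite_measure_of sfM).
Qed.

(* The centre is a sequence, so that the tail of a box centred at [p] is centred
   at [p \o S]. *)
Definition tbox (R : realType) n (p : nat -> R) (r : R) :
    set (n.-tuple (measurableTypeR R)) :=
  [set s | forall i : 'I_n, `|tnth s i - p i| < r].

Lemma measurable_tbox (R : realType) n p r : measurable (@tbox R n p r).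
Proof.
have -> : tbox p r = \bigcap_(i in [set: 'I_n])
    ((@tnth _ (measurableTypeR R))^~ i @^-1` ball (p i) r).
  apply/seteqP; split=> s /= H.
    by move=> i _; rewrite /= /ball/= distrC; exact: H.
  by move=> i; have := H i Logic.I; rewrite /= /ball/= distrC.
apply: fin_bigcap_measurable => // i _; rewrite -[X in measurable X]setTI.
by apply: measurable_tnth => //; exact: measurable_ball.
Qed.

Definition tadd (R : realType) n (v s : n.-tuple (measurableTypeR R)) :
    n.-tuple (measurableTypeR R) :=
  [tuple (tnth s i + tnth v i : R) | i < n].

(** The properties go through one induction on [n], since the product at the successor step needs a
    sigma-finite measure in dimension [n]. The bounds on boxes supply sigma-finiteness. For [n = 0]
    the measure is a Dirac mass, hence the restriction on the last clause. *)
Lemma lebesgue_measure_tuple_spec (R : realType) n :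
  exists m : {sigma_finite_measure set (n.-tuple (measurableTypeR R)) -> \bar R},
  [/\ m = @lebesgue_measure_tuple R n :> (set _ -> \bar R),
      forall p r, 0 < r -> (0 < m (tbox p r) < +oo)%E,
      forall v A, measurable A -> m (tadd v @^-1` A) = m A &
      (0 < n)%N -> m [set [tuple (0 : R) | i < n]] = 0%E].
Proof.
elim: n => [|n [m [mE mbox mD m0]]].
  exists (dirac [tuple]); split => //.
  - move=> p r r0; rewrite /= diracE mem_set ?lte01 ?ltry//.
    by move=> [].
  - move=> v A mA; congr (_ _); apply/seteqP; split=> s /=.
      by rewrite (tuple0 (tadd v s)) (tuple0 s).
    by rewrite (tuple0 (tadd v s)) (tuple0 s).
pose f (p : measurableTypeR R * n.-tuple (measurableTypeR R)) :=
  [tuple of p.1 :: p.2].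
have mf : measurable_fun setT f by exact: measurable_cons.
have fbox p r : f @^-1` tbox p r = ball (p 0%N) r `*` tbox (p \o S) r.
  apply/seteqP; split=> -[x s] /=; rewrite /tbox/=.
    move=> H; split.
      by have := H ord0; rewrite tnth0 /ball/= distrC.
    by move=> i; have := H (lift ord0 i); rewrite tnthS.
  case; rewrite /ball/= distrC => H0 H i.
  by case: (unliftP ord0 i) => [j|] ->; rewrite ?tnthS ?tnth0//; exact: H.
have fD v x s : tadd v (f (x, s)) =
    f ((x : R) + thead v, tadd [tuple of behead v] s).
  apply: eq_from_tnth => i; rewrite tnth_mktuple.
  case: (unliftP ord0 i) => [j|] ->; rewrite ?tnthS ?tnth0 ?tnth_mktuple//=.
  rewrite tnth_behead; congr (_ + tnth v _).
  by apply: val_inj; rewrite /= inordK// ltnS.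
have boxE p r : 0 < r -> (lebesgue_measure \x m)%E (f @^-1` tbox p r) =
    ((r *+ 2)%:E * m (tbox (p \o S) r))%E.
  move=> r0; rewrite fbox product_measure1E//; last exact: measurable_tbox.
    by rewrite -(lebesgue_measure_ball (p 0%N) (ltW r0)).
  exact: measurable_ball.
have boxoo p r : 0 < r ->
    (0 < (lebesgue_measure \x m)%E (f @^-1` tbox p r) < +oo)%E.
  move=> r0; rewrite boxE//.
  have /andP[a b] := mbox (p \o S) r r0.
  rewrite mule_gt0//=; last by rewrite lte_fin pmulrn_lgt0.
  by rewrite lte_mul_pinfty// lee_fin mulrn_wge0// ltW.
have cover : [set: n.+1.-tuple (measurableTypeR R)] =
    \bigcup_k tbox (fun=> 0) k.+1%:R.
  apply/esym; rewrite -subTset => s _.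
  have [k sk] : exists k : nat, forall i, `|tnth s i| < k%:R.
    exists (Num.truncn (\big[Num.max/0]_(i < n.+1) `|tnth s i : R|)).+1 => i.
    apply: le_lt_trans (truncnS_gt _).
    exact: (le_bigmax _ (fun i => `|tnth s i : R|)).
  exists k => // i; rewrite subr0 (lt_le_trans (sk i))// ler_nat.
  exact: leqnSn.
have [M ME] := sigma_finite_pushforward (m := (lebesgue_measure \x m)%E) mf
  (fun k => measurable_tbox _ _) cover
  (fun k => proj2 (andP (boxoo (fun=> 0) k.+1%:R (ltr0Sn _ _)))).
exists M; rewrite ME; split.
- by rewrite /= mE.
- exact: boxoo.
- move=> v A mA; rewrite /pushforward.
  set X := f @^-1` A.
  have mX : measurable X by rewrite -[X]setTI; exact: mf.
  (* The product measure integrates the measures of the sections: the induction hypothesis absorbs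
     the translation by the tail of [v], and the translation by its head is a change of variable on
     the line. *)
  transitivity (\int[lebesgue_measure]_x
      ((m \o xsection X) \o (fun x : R => (x + thead v)%R)) x)%E.
    apply: eq_integral => x _ /=.
    rewrite -[RHS](mD [tuple of behead v]); last exact: measurable_xsection.
    congr (m _); apply/seteqP; split=> s;
      by rewrite /preimage /xsection /= !inE /X /preimage /= fD.
  pose phi x := m (xsection X x).
  have mphi : measurable_fun setT phi by exact: measurable_fun_xsection.
  have mshift : @measurable_fun _ _ (measurableTypeR R) (measurableTypeR R) setT
      (fun x => (x : R) + thead v) by exact: measurable_funD.
  rewrite -[LHS](ge0_integral_pushforward mshift lebesgue_measure (D := setT)
    (f := phi))//.
  by apply: eq_measure_integral => A' mA' _ /=; rewrite lebesgue_measureD.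
- move=> _; rewrite /pushforward.
  have -> : f @^-1` [set [tuple 0  | _ < n.+1]] =
      [set 0] `*` [set [tuple 0 | _ < n]].
    apply/seteqP; split=> -[x s] /=.
      move=> fE; split.
        by have := congr1 (fun t => tnth t ord0) fE; rewrite tnth0 tnth_mktuple.
      apply: eq_from_tnth => i.
      by have := congr1 (fun t => tnth t (lift ord0 i)) fE;
        rewrite tnthS !tnth_mktuple.
    move=> [-> ->]; apply: eq_from_tnth => i; rewrite tnth_mktuple.
    by case: (unliftP ord0 i) => [j|] ->; rewrite ?tnthS ?tnth0 ?tnth_mktuple.
  set Z := [set [tuple 0 | _ < n]].
  (* The factor {0} on the line is null, so it remains to see that [Z] is measurable: it is the
     intersection of the boxes of radius 1/(k+1). *)
  transitivity (lebesgue_measure [set (0 : R)%R] * m Z)%E;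
    last by rewrite lebesgue_measure_set1 mul0e.
  apply: product_measure1E => //.
  rewrite (_ : Z = \bigcap_k tbox (fun=> 0) k.+1%:R^-1).
    by apply: bigcap_measurableType => k _; exact: measurable_tbox.
  apply/seteqP; split=> s /=.
    by move=> -> k _ i; rewrite tnth_mktuple subrr normr0 invr_gt0.
  move=> H; apply: eq_from_tnth => i; rewrite tnth_mktuple.
  apply/eqP; rewrite -normr_le0 leNgt; apply/negP => s0.
  have := H (Num.truncn (`|tnth s i|^-1)) Logic.I i; rewrite subr0.
  apply/negP; rewrite -leNgt -[leRHS]invrK lef_pV2 ?posrE ?invr_gt0//.
  by apply/ltW; exact: truncnS_gt.
Qed.

(** * Borel row vectors *)

(* The measure lives on tuples; transporting it to row vectors with their Borel
   sets makes the vector space operations available. *)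
Notation borelRow R n := (g_sigma_algebraType (@open 'rV[R]_n)).

Lemma measurable_coord (R : realType) n (i : 'I_n) :
  measurable_fun setT (fun x : borelRow R n => (x : 'rV[R]_n) 0 i).
Proof.
apply: (measurability _ (RGenOInfty.measurableE R)) => _ [_ [a ->] <-].
rewrite setTI; apply: sub_sigma_algebra; apply: open_comp => [x _|].
  exact: coord_continuous.
exact: interval_open.
Qed.

(** An open set is the union of the countably many boxes inside it with rational centre and radius
    1/(k+1), and the preimage of a box is a finite intersection of measurable sets. *)
Lemma open_measurable_rows d (T : measurableType d) (R : realType) n
    (f : T -> 'rV[R]_n) (U : set 'rV[R]_n) :
  (forall i, measurable_fun setT (fun t => f t 0 i)) ->
  open U -> measurable (f @^-1` U).
Proof.
move=> mf oU.
pose box (qk : {ffun 'I_n -> rat} * nat) : set 'rV[R]_n :=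
  [set x | forall i, `|x 0 i - ratr (qk.1 i)| < qk.2.+1%:R^-1].
pose D : set ({ffun 'I_n -> rat} * nat) := [set qk | box qk `<=` U].
have -> : U = \bigcup_(qk in D) box qk.
  apply/seteqP; split=> [x Ux|x [qk]]; last by apply.
  have /nbhs_ballP[e /= e0 eU] : nbhs x U by apply: open_nbhs_nbhs.
  (* With this [k] one has 2/(k+1) < e, so two points of the same box are less than [e] apart. *)
  pose k := Num.truncn (e / 2)^-1.
  have ke : 2 * k.+1%:R^-1 < e.
    have : (e / 2)^-1 < k.+1%:R by exact: truncnS_gt.
    rewrite -[ltRHS]invrK ltf_pV2 ?posrE ?invr_gt0 ?divr_gt0//.
    by rewrite ltr_pdivlMr// mulrC.
  have /all_sig[q qx] i : {q : rat | `|x 0 i - ratr q| < k.+1%:R^-1}.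
    apply: cid.
    have /rat_in_itvoo[q] : x 0 i - k.+1%:R^-1 < x 0 i + k.+1%:R^-1.
      by rewrite ltrBlDr -addrA ltrDl addr_gt0// invr_gt0.
    by rewrite in_itv/= -ltr_distlC; exists q.
  exists ([ffun i => q i], k); last by move=> i; rewrite ffunE.
  move=> y yq; apply: eU; split => // a i; rewrite {a}ord1 /ball/=.
  apply: lt_trans ke; rewrite mulr_natl mulr2n.
  have := yq i; rewrite ffunE /= => yqi.
  apply: le_lt_trans (ltrD (qx i) yqi).
  rewrite (distrC (y 0 i)); apply: le_trans (ler_normD _ _).
  by rewrite addrA subrK.
rewrite preimage_bigcup bigcup_mkcond.
apply: countable_bigcupT_measurable; first exact: countableP.
move=> qk; case: ifP => _; last exact: measurable0.
have -> : f @^-1` box qk = \bigcap_(i in [set: 'I_n])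
    (fun t => f t 0 i) @^-1` (ball (ratr (qk.1 i) : R) qk.2.+1%:R^-1).
  apply/seteqP; split=> t /= H i => [_|]; rewrite /ball/= distrC.
    exact: H.
  by rewrite distrC; have := H i Logic.I; rewrite /= /ball/= distrC.
apply: fin_bigcap_measurable => // i _; rewrite -[X in measurable X]setTI.
by apply: mf => //; exact: measurable_ball.
Qed.

Lemma measurable_fun_rows d (T : measurableType d) (R : realType) n
    (f : T -> borelRow R n) :
  (forall i, measurable_fun setT (fun t => (f t : 'rV[R]_n) 0 i)) ->
  measurable_fun setT f.
Proof.
move=> mf; apply: (@measurability _ _ T (borelRow R n) setT f (@open 'rV[R]_n) erefl).
move=> _ [U oU <-].
by rewrite setTI; exact: open_measurable_rows.
Qed.

Lemma borelRow_measure_ex (R : realType) n :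
  exists m : {sigma_finite_measure set (borelRow R n) -> \bar R},
  [/\ m = @vol R n :> (set _ -> \bar R),
      forall (p : 'rV[R]_n) r, 0 < r -> (0 < m (ball p r) < +oo)%E,
      forall (v : 'rV[R]_n) (A : set (borelRow R n)), measurable A ->
        m ((fun x : 'rV[R]_n => x + v) @^-1` A) = m A &
      (0 < n)%N -> m [set (0 : 'rV[R]_n)] = 0%E].
Proof.
have [m [mE mbox mD m0]] := lebesgue_measure_tuple_spec R n.
pose f (s : n.-tuple (measurableTypeR R)) : borelRow R n :=
  \row_(i < n) (tnth s i : R).
have mf : measurable_fun setT f.
  apply: measurable_fun_rows => i.
  have -> : (fun t => (f t : 'rV[R]_n) 0 i) = (@tnth _ (measurableTypeR R))^~ i.
    by apply/funext => s; rewrite mxE.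
  exact: measurable_tnth.
(* The norm of row vectors is the sup norm, so balls pull back to boxes; [p] is extended by 0 to a
   sequence. *)
have fbox (p : 'rV[R]_n) r : 0 < r ->
    f @^-1` ball p r = tbox (fun i => if insub i is Some j then p 0 j else 0) r.
  move=> r0; apply/seteqP; split=> s; rewrite /tbox/=.
    move=> [_ H] i; have := H 0 i; rewrite mxE /ball/= distrC.
    by rewrite valK.
  move=> H; split => // a i; rewrite {a}ord1 mxE /ball/= distrC.
  by have := H i; rewrite valK.
have boxoo (p : 'rV[R]_n) r : 0 < r -> (0 < m (f @^-1` ball p r) < +oo)%E.
  by move=> r0; rewrite fbox//; exact: mbox.
pose F k : set (borelRow R n) := ball (0 : 'rV[R]_n) k.+1%:R.
have mF k : measurable (F k).
  by apply: sub_sigma_algebra; apply: ball_open; exact: ltr0Sn.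
have cover : setT = \bigcup_k F k.
  apply/esym; rewrite -subTset => x _.
  exists (Num.truncn `|(x : 'rV[R]_n)|) => //.
  by rewrite /F -ball_normE /ball_/= sub0r normrN truncnS_gt.
have [M ME] := sigma_finite_pushforward mf mF cover
  (fun k => proj2 (andP (boxoo 0 k.+1%:R (ltr0Sn _ _)))).
exists M; rewrite ME; split.
- by rewrite /vol -mE.
- exact: boxoo.
- move=> v A mA; rewrite /pushforward.
  rewrite -[RHS](mD [tuple v 0 i | i < n]); last first.
    by rewrite -[X in measurable X]setTI; exact: mf.
  congr (m _); rewrite /preimage; apply/funext => s /=; congr A.
  by apply/rowP => i; rewrite !mxE !tnth_mktuple.
- move=> n0; rewrite /pushforward -[RHS](m0 n0).
  congr (m _); apply/seteqP; split=> s /=.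
    move=> /rowP s0; apply: eq_from_tnth => i.
    by have := s0 i; rewrite !mxE tnth_mktuple.
  by move=> ->; apply/rowP => i; rewrite !mxE tnth_mktuple.
Qed.

(** * Euclidean geometry and Fubini *)

(** The set function [vol], equipped with the structure that Fubini and monotonicity require. *)
Definition rowVol (R : realType) n :
    {sigma_finite_measure set (borelRow R n) -> \bar R} :=
  sval (cid (borelRow_measure_ex R n)).

Lemma rowVolE (R : realType) n : rowVol R n = @vol R n :> (set _ -> \bar R).
Proof. by have [] := svalP (cid (borelRow_measure_ex R n)). Qed.

Lemma rowVol_ball (R : realType) n (p : 'rV[R]_n) r :
  0 < r -> (0 < rowVol R n (ball p r) < +oo)%E.
Proof. by have [_ H _ _] := svalP (cid (borelRow_measure_ex R n)); exact: H. Qed.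

Lemma rowVolD (R : realType) n (v : 'rV[R]_n) (A : set (borelRow R n)) :
  measurable A -> rowVol R n ((fun x : 'rV[R]_n => x + v) @^-1` A) = rowVol R n A.
Proof. by have [_ _ H _] := svalP (cid (borelRow_measure_ex R n)); exact: H. Qed.

Lemma rowVol_set0 (R : realType) n :
  (0 < n)%N -> rowVol R n [set (0 : 'rV[R]_n)] = 0%E.
Proof. by have [_ _ _ H] := svalP (cid (borelRow_measure_ex R n)); exact: H. Qed.

Lemma open_rowVol_gt0 (R : realType) n (U : set 'rV[R]_n) :
  open U -> U !=set0 -> (0 < rowVol R n U)%E.
Proof.
move=> oU [p Up].
have /nbhs_ballP[e /= e0 eU] : nbhs p U by apply: open_nbhs_nbhs.
have /andP[b0 _] := rowVol_ball p e0.
apply: (lt_le_trans b0); apply: le_measure => //; rewrite inE.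
  by apply: sub_sigma_algebra; exact: ball_open.
exact: sub_sigma_algebra.
Qed.

Lemma dotmulE (R : realType) n (u v : 'rV[R]_n) : dotmul u v = (u *m v^T) 0 0.
Proof. by rewrite mxE; apply: eq_bigr => i _; rewrite mxE. Qed.

Lemma dotmulC (R : realType) n (u v : 'rV[R]_n) : dotmul u v = dotmul v u.
Proof. by apply: eq_bigr => i _; rewrite mulrC. Qed.

Lemma dotmulDl (R : realType) n (u v w : 'rV[R]_n) :
  dotmul (u + v) w = dotmul u w + dotmul v w.
Proof. by rewrite !dotmulE mulmxDl mxE. Qed.

Lemma dotmulZl (R : realType) n a (u v : 'rV[R]_n) :
  dotmul (a *: u) v = a * dotmul u v.
Proof. by rewrite !dotmulE -scalemxAl mxE. Qed.

Lemma dotmulDr (R : realType) n (u v w : 'rV[R]_n) :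
  dotmul w (u + v) = dotmul w u + dotmul w v.
Proof. by rewrite dotmulC dotmulDl !(dotmulC w). Qed.

Lemma dotmulZr (R : realType) n a (u v : 'rV[R]_n) :
  dotmul u (a *: v) = a * dotmul u v.
Proof. by rewrite dotmulC dotmulZl dotmulC. Qed.

Lemma dotmulNl (R : realType) n (u v : 'rV[R]_n) : dotmul (- u) v = - dotmul u v.
Proof. by rewrite -scaleN1r dotmulZl mulN1r. Qed.

Lemma dotmulNr (R : realType) n (u v : 'rV[R]_n) : dotmul u (- v) = - dotmul u v.
Proof. by rewrite dotmulC dotmulNl dotmulC. Qed.

Lemma sqr_coord_le (R : realType) n (u : 'rV[R]_n) i :
  u 0 i ^+ 2 <= dotmul u u.
Proof.
by rewrite /dotmul (bigD1 i)//= expr2 lerDl sumr_ge0// => j _; rewrite -expr2 sqr_ge0.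
Qed.

Lemma dotmul_ge0 (R : realType) n (u : 'rV[R]_n) : 0 <= dotmul u u.
Proof. by rewrite sumr_ge0// => i _; rewrite -expr2 sqr_ge0. Qed.

Lemma dotmul_gt0 (R : realType) n (u : 'rV[R]_n) : (0 < dotmul u u) = (u != 0).
Proof.
rewrite lt0r dotmul_ge0 andbT; congr (~~ _); apply/eqP/eqP => [u0|->].
  apply/rowP => i; rewrite mxE; apply/eqP; rewrite -sqrf_eq0.
  by rewrite eq_le sqr_ge0 andbT -u0 sqr_coord_le.
by rewrite /dotmul big1// => i _; rewrite mxE mul0r.
Qed.

Lemma dotmul_orthogonal (R : realType) n (Phi : 'M[R]_n) (u v : 'rV[R]_n) :
  Phi *m Phi^T = 1%:M -> dotmul (u *m Phi) (v *m Phi) = dotmul u v.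
Proof. by move=> PhiT; rewrite !dotmulE trmx_mul mulmxA -(mulmxA u) PhiT mulmx1. Qed.

Lemma measurable_dotmul d (T : measurableType d) (R : realType) n
    (f g : T -> borelRow R n) : measurable_fun setT f -> measurable_fun setT g ->
  measurable_fun setT (fun t => dotmul (f t : 'rV[R]_n) (g t)).
Proof.
move=> mf mg; apply: measurable_sum => i; apply: measurable_funM.
  exact: (measurableT_comp (measurable_coord i) mf).
exact: (measurableT_comp (measurable_coord i) mg).
Qed.

(** The Euclidean ball: unlike the sup-norm [ball], it is invariant under orthogonal matrices. *)
Definition unit_ball (R : realType) n : set (borelRow R n) :=
  [set x : 'rV[R]_n | dotmul x x <= 1].

Lemma measurable_set_of d (T : measurableType d) (b : T -> bool) :
  measurable_fun setT b -> measurable [set t | b t].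
Proof.
move=> mb; have := mb measurableT [set true] Logic.I; rewrite setTI.
by congr measurable; apply/seteqP; split.
Qed.

Lemma measurable_unit_ball (R : realType) n : measurable (@unit_ball R n).
Proof.
apply: measurable_set_of; apply: measurable_fun_ler => //.
by apply: measurable_dotmul; exact: measurable_id.
Qed.

Lemma unit_ball_gt0 (R : realType) n : (0 < rowVol R n (@unit_ball R n))%E.
Proof.
(* In the sup-norm ball of radius 1/(n+1), each of the [n] squares is at most 1/(n+1), so their sum
   is at most 1. *)
have r0 : 0 < n.+1%:R^-1 :> R by rewrite invr_gt0.
have /andP[b0 _] := rowVol_ball (0 : 'rV[R]_n) r0.
apply: (lt_le_trans b0); apply: le_measure; rewrite ?inE.
- by apply: sub_sigma_algebra; apply: ball_open; rewrite invr_gt0.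
- exact: measurable_unit_ball.
move=> x [_ bx]; rewrite /unit_ball/=.
apply: (@le_trans _ _ (\sum_(i < n) n.+1%:R^-1)).
  apply: ler_sum => i _; have := bx 0 i; rewrite mxE /ball/= sub0r normrN => /ltW xi.
  rewrite -expr2 -real_normK ?num_real// expr2.
  apply: le_trans (ler_pM _ _ xi xi) _ => //.
  by rewrite ler_piMr ?invr_ge0// invf_le1// ler1n.
rewrite sumr_const card_ord -[leLHS]mulr_natr mulrC ler_pdivrMr// mul1r ler_nat.
exact: leqnSn.
Qed.

Lemma unit_ball_lty (R : realType) n : (rowVol R n (@unit_ball R n) < +oo)%E.
Proof.
have /andP[_ boo] := rowVol_ball (0 : 'rV[R]_n) (ltr0Sn R 1).
apply: le_lt_trans boo; apply: le_measure; rewrite ?inE.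
- exact: measurable_unit_ball.
- by apply: sub_sigma_algebra; exact: ball_open.
move=> x; rewrite /unit_ball/= => x1; split => // a i.
rewrite {a}ord1 mxE /ball/= sub0r normrN.
rewrite -(@ltr_pXn2r _ 2) ?nnegrE// real_normK ?num_real//.
apply: le_lt_trans (sqr_coord_le _ _) (le_lt_trans x1 _).
by rewrite -natrX ltr1n.
Qed.

(** Tonelli for an indicator: the right-hand side is a measure with the product values on
    rectangles, so it is the product measure. *)
Lemma integral_sections d1 d2 (T1 : measurableType d1) (T2 : measurableType d2)
    (R : realType) (m1 : {sigma_finite_measure set T1 -> \bar R})
    (m2 : {sigma_finite_measure set T2 -> \bar R}) (E : set (T1 * T2)) :
  measurable E ->
  (\int[m1]_x m2 (xsection E x) = \int[m2]_y m1 (ysection E y))%E.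
Proof.
by move=> mE; apply: (@product_measure_unique _ _ _ _ _ m1 m2 (m1 \x^ m2)%E) => //
  A B mA mB; exact: product_measure2E.
Qed.

Lemma integral_if_cst d (T : measurableType d) (R : realType)
    (m : {measure set T -> \bar R}) (A : set T) (c : \bar R) (phi : T -> \bar R) :
  measurable A -> (0 <= c)%E -> (forall x, A x -> phi x = c) ->
  (forall x, ~ A x -> phi x = 0%E) -> (\int[m]_x phi x = c * m A)%E.
Proof.
move=> mA c0 phiA phiNA.
rewrite (eq_integral (fun x => c * (\1_A x)%:E)%E); last first.
  move=> x _; rewrite indicE; have [xA|xA] := boolP (x \in A).
    by rewrite mule1; apply: phiA; rewrite inE in xA.
  by rewrite mule0; apply: phiNA; rewrite notin_setE in xA.
rewrite ge0_integralZl ?integral_indic ?setIT//.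
exact: measurableT_comp.
Qed.

Lemma measurable_mulmx d (T : measurableType d) (R : realType) n
    (f : T -> borelRow R n) (Phi : 'M[R]_n) : measurable_fun setT f ->
  measurable_fun setT (fun t => (f t : 'rV[R]_n) *m Phi : borelRow R n).
Proof.
move=> mf; apply: measurable_fun_rows => i.
under eq_fun do rewrite mxE.
apply: measurable_sum => j; apply: measurable_funM => //.
exact: (measurableT_comp (measurable_coord j) mf).
Qed.

Lemma measurable_addrow d (T : measurableType d) (R : realType) n
    (f g : T -> borelRow R n) : measurable_fun setT f -> measurable_fun setT g ->
  measurable_fun setT (fun t => (f t : 'rV[R]_n) + g t : borelRow R n).
Proof.
move=> mf mg; apply: measurable_fun_rows => i.
under eq_fun do rewrite mxE.
apply: measurable_funD.
  exact: (measurableT_comp (measurable_coord i) mf).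
exact: (measurableT_comp (measurable_coord i) mg).
Qed.

(** * Orthogonal invariance *)

(* With B the unit ball, Fubini and translation invariance evaluate the measure of
   {(z, y) : z in B, z - y Phi in A} as |B| |{y : - y Phi in A}| on one side and
   as |A| |B| on the other. *)
Lemma rowVol_orthogonalN (R : realType) n (Phi : 'M[R]_n)
    (A : set (borelRow R n)) : Phi *m Phi^T = 1%:M -> measurable A ->
  rowVol R n ((fun y : 'rV[R]_n => - (y *m Phi)) @^-1` A) = rowVol R n A.
Proof.
move=> PhiT mA.
have TPhi : Phi^T *m Phi = 1%:M by exact: mulmx1C.
pose m := rowVol R n; pose B := @unit_ball R n.
have mB : measurable B by exact: measurable_unit_ball.
pose NA : set (borelRow R n) := (fun y : 'rV[R]_n => - (y *m Phi)) @^-1` A.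
change (m NA = m A).
have mNA : measurable NA.
  rewrite -[NA]setTI.
  suff : measurable_fun setT (fun y : borelRow R n =>
      - ((y : 'rV[R]_n) *m Phi) : borelRow R n) by apply.
  under eq_fun do rewrite -mulmxN.
  by apply: measurable_mulmx; exact: measurable_id.
pose E : set (borelRow R n * borelRow R n) :=
  [set p | B p.1 /\ A ((p.1 : 'rV[R]_n) - (p.2 : 'rV[R]_n) *m Phi)].
pose E' : set (borelRow R n * borelRow R n) :=
  [set p | A p.1 /\ B ((p.1 : 'rV[R]_n) + (p.2 : 'rV[R]_n) *m Phi)].
have mE : measurable E.
  apply: measurableI; rewrite -[X in measurable X]setTI.
    exact: measurable_fst.
  suff : measurable_fun setT (fun p : borelRow R n * borelRow R n =>
    (p.1 : 'rV[R]_n) - (p.2 : 'rV[R]_n) *m Phi : borelRow R n) by apply.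
  under eq_fun do rewrite -mulmxN.
  by apply: measurable_addrow => //; apply: measurable_mulmx.
have mE' : measurable E'.
  apply: measurableI; rewrite -[X in measurable X]setTI.
    exact: measurable_fst.
  suff : measurable_fun setT (fun p : borelRow R n * borelRow R n =>
    (p.1 : 'rV[R]_n) + (p.2 : 'rV[R]_n) *m Phi : borelRow R n) by apply.
  by apply: measurable_addrow => //; apply: measurable_mulmx.
(* For [z] in [B], the section of [E] is the translate of [NA] by z Phi^T. *)
have EB : (\int[m]_z m (xsection E z) = m NA * m B)%E.
  apply: integral_if_cst => // z Bz.
    rewrite -(rowVolD (- ((z : 'rV[R]_n) *m Phi^T)) mNA); congr (m _).
    apply/seteqP; split=> y; rewrite /xsection/NA/E/preimage/= inE/=;
      rewrite mulmxDl mulNmx -mulmxA TPhi mulmx1 opprD opprK addrC; tauto.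
  rewrite (_ : xsection _ _ = set0) ?measure0//.
  by apply/seteqP; split=> // y; rewrite /xsection/= inE => -[].
(* Since [B] is orthogonally invariant, z + y Phi lies in [B] exactly when y + z Phi^T does, so the
   section of [E'] at [z] in [A] is a translate of [B]. *)
have EA : (\int[m]_z m (xsection E' z) = m B * m A)%E.
  apply: integral_if_cst => // z Az.
    rewrite -(rowVolD ((z : 'rV[R]_n) *m Phi^T) mB); congr (m _).
    have Beq (y : 'rV[R]_n) :
        B (z + y *m Phi) = B (y + (z : 'rV[R]_n) *m Phi^T).
      rewrite /B/unit_ball/= -(dotmul_orthogonal (y + _) (y + _) PhiT).
      by rewrite mulmxDl -mulmxA TPhi mulmx1 addrC.
    apply/seteqP; split=> y; rewrite /xsection/E'/preimage/= inE/= Beq; tauto.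
  rewrite (_ : xsection _ _ = set0) ?measure0//.
  by apply/seteqP; split=> // y; rewrite /xsection/= inE => -[].
(* For fixed [y], the substitution of z + y Phi for z turns the section of [E] into that of [E']. *)
have EE' : (\int[m]_y m (ysection E y) = \int[m]_y m (ysection E' y))%E.
  apply: eq_integral => y _.
  rewrite -(rowVolD ((y : 'rV[R]_n) *m Phi)); last exact: measurable_ysection.
  congr (m _); apply/seteqP; split=> z;
    by rewrite /ysection/E/E'/preimage/= !inE/= addrK => -[].
have NAB : (m NA * m B = m A * m B)%E.
  by rewrite -EB integral_sections// EE' -integral_sections// EA muleC.
have B0 : (0 < m B)%E by exact: unit_ball_gt0.
have Bfin : m B \is a fin_num.
  by rewrite ge0_fin_numE ?measure_ge0//; exact: unit_ball_lty.
by apply/le_anti/andP; split; rewrite -(lee_pmul2r Bfin B0) NAB.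
Qed.

(** The matrix [- Phi] is orthogonal too, which removes the sign. *)
Lemma rowVol_orthogonal (R : realType) n (Phi : 'M[R]_n)
    (A : set (borelRow R n)) : Phi *m Phi^T = 1%:M -> measurable A ->
  rowVol R n ((fun y : 'rV[R]_n => y *m Phi) @^-1` A) = rowVol R n A.
Proof.
move=> PhiT mA; rewrite -[RHS](@rowVol_orthogonalN _ _ (- Phi))//; last first.
  by rewrite linearN/= mulmxN mulNmx opprK.
by congr (rowVol R n _); apply/funext => y; rewrite /preimage/= mulmxN opprK.
Qed.

(** Transitivity of the orthogonal group on spheres, used to move the axis of one slab cap to that
    of another. *)
Lemma reflection_ex (R : realType) n (a b : 'rV[R]_n) :
  dotmul a a = dotmul b b ->
  exists Phi : 'M[R]_n, Phi *m Phi^T = 1%:M /\ a *m Phi = b.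
Proof.
move=> ab; have [->|neq] := eqVneq a b.
  by exists 1%:M; rewrite trmx1 !mulmx1.
have [v vE] : {v | v = a - b} by exists (a - b).
pose d := dotmul v v.
have d0 : d != 0 by rewrite gt_eqF// dotmul_gt0 vE subr_eq0.
(* The equality of lengths enters here; it makes the reflection subtract exactly [v] from [a]. *)
have dE : d = 2 * dotmul a v.
  rewrite /d vE !(dotmulDl, dotmulDr, dotmulNl, dotmulNr) -ab (dotmulC b a); ring.
have vv : v *m v^T = d%:M by apply/matrixP => i j; rewrite !ord1 -dotmulE !mxE.
(* The symmetric matrix N = v^T v satisfies N^2 = d N, so 1 - (2/d) N is a symmetric involution,
   hence orthogonal. *)
have NN : (v^T *m v) *m (v^T *m v) = d *: (v^T *m v).
  by rewrite mulmxA -(mulmxA v^T) vv mul_mx_scalar -scalemxAl.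
have NT i j : (v^T *m v) i j = (v^T *m v) j i.
  by rewrite !mxE; apply: eq_bigr => k _; rewrite !mxE mulrC.
(* Householder reflection exchanging a and b *)
exists (1%:M - (2 / d) *: (v^T *m v)); split.
  set Q := 1%:M - _.
  have -> : Q^T = Q.
    rewrite /Q; move: (v^T *m v) NT => N NT.
    by apply/matrixP => i j; rewrite !mxE NT eq_sym.
  rewrite /Q mulmxBl mul1mx mulmxBr mulmx1 -scalemxAl -scalemxAr NN !scalerA.
  rewrite (_ : 2 / d * (2 / d) * d = 2 / d + 2 / d); last by field.
  by rewrite scalerDl opprB addrK subrK.
rewrite mulmxBr mulmx1 -scalemxAr mulmxA.
have -> : a *m v^T = (dotmul a v)%:M.
  by apply/matrixP => i j; rewrite !ord1 -dotmulE !mxE.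
rewrite mul_scalar_mx scalerA (_ : 2 / d * dotmul a v = 1).
  by rewrite scale1r vE opprB addrC subrK.
by rewrite mulrAC -dE divff.
Qed.

(** * Slabs *)

Lemma continuous_dotmul (T : topologicalType) (R : realType) n
    (f g : T -> 'rV[R]_n) : continuous f -> continuous g ->
  continuous (fun t => dotmul (f t) (g t)).
Proof.
move=> cf cg; apply: continuous_big => [p|i _ x].
  by apply: cvgD; [exact: cvg_fst|exact: cvg_snd].
apply: cvgM.
  apply: (@continuous_comp _ _ _ f (fun v : 'rV[R]_n => v 0 i)); first exact: cf.
  exact: coord_continuous.
apply: (@continuous_comp _ _ _ g (fun v : 'rV[R]_n => v 0 i)); first exact: cg.
exact: coord_continuous.
Qed.

(** The angle between [x] and [y] has squared cosine below [e]. Without division the condition is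
    homogeneous in both vectors, and strictness excludes zero vectors. *)
Definition slab (R : realType) n (e : R) (x y : 'rV[R]_n) : bool :=
  dotmul x y ^+ 2 < e * dotmul x x * dotmul y y.

Lemma slab_neq0l (R : realType) n e (x y : 'rV[R]_n) : slab e x y -> x != 0.
Proof.
apply: contraTneq => ->; rewrite /slab -leNgt.
have -> : dotmul (0 : 'rV[R]_n) 0 = 0.
  by rewrite -(scale0r (0 : 'rV[R]_n)) dotmulZl mul0r.
by rewrite mulr0 mul0r sqr_ge0.
Qed.

Lemma slabC (R : realType) n e (x y : 'rV[R]_n) : slab e x y = slab e y x.
Proof. by rewrite /slab dotmulC mulrAC. Qed.

Lemma slab_orthogonal (R : realType) n e (Phi : 'M[R]_n) (x y : 'rV[R]_n) :
  Phi *m Phi^T = 1%:M -> slab e (x *m Phi) (y *m Phi) = slab e x y.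
Proof. by move=> PhiT; rewrite /slab !dotmul_orthogonal. Qed.

Lemma slabZr (R : realType) n e c (x y : 'rV[R]_n) :
  c != 0 -> slab e x (c *: y) = slab e x y.
Proof.
move=> c0; rewrite /slab !(dotmulZl, dotmulZr).
rewrite (_ : _ * (c * _) = c ^+ 2 * (e * dotmul x x * dotmul y y)); last by ring.
by rewrite exprMn ltr_pM2l// exprn_even_gt0.
Qed.

Lemma measurable_slab d (T : measurableType d) (R : realType) n e
    (f g : T -> borelRow R n) : measurable_fun setT f -> measurable_fun setT g ->
  measurable [set t | slab e (f t : 'rV[R]_n) (g t)].
Proof.
move=> mf mg; apply: measurable_set_of; apply: measurable_fun_ltr.
  by apply: measurable_funX; exact: measurable_dotmul.
by apply: measurable_funM; [apply: measurable_funM => //|];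
  exact: measurable_dotmul.
Qed.

Definition slab_cap (R : realType) n (e : R) (x : 'rV[R]_n) :
    set (borelRow R n) :=
  [set y | unit_ball y /\ slab e (y : 'rV[R]_n) x].

Lemma measurable_slab_cap (R : realType) n (e : R) (x : 'rV[R]_n) :
  measurable (slab_cap e x).
Proof.
apply: measurableI; first exact: measurable_unit_ball.
by apply: measurable_slab => //; exact: measurable_cst.
Qed.

(** Both axes can be normalised by homogeneity; an orthogonal matrix carrying one to the other
    preserves the ball, the slab relation and the measure. *)
Lemma rowVol_slab_cap (R : realType) n (e : R) (x y : 'rV[R]_n) :
  x != 0 -> y != 0 -> rowVol R n (slab_cap e x) = rowVol R n (slab_cap e y).
Proof.
have nrm (z : 'rV[R]_n) : z != 0 ->
    exists2 c, c != 0 & dotmul (c *: z) (c *: z) = 1.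
  rewrite -dotmul_gt0 => z0; exists (Num.sqrt (dotmul z z))^-1.
    by rewrite invr_eq0 gt_eqF// sqrtr_gt0.
  rewrite dotmulZl dotmulZr -{3}(sqr_sqrtr (ltW z0)).
  have : Num.sqrt (dotmul z z) != 0 by rewrite gt_eqF// sqrtr_gt0.
  by move=> ?; field.
move=> /nrm[c c0 cx] /nrm[d d0 dy].
have [Phi [PhiT xPhi]] := reflection_ex (etrans cx (esym dy)).
rewrite -(rowVol_orthogonal PhiT (measurable_slab_cap e y)).
have sE (z : 'rV[R]_n) : slab e (z *m Phi) y = slab e z x.
  by rewrite -(slabZr e _ y d0) -xPhi slab_orthogonal// slabZr.
by congr (rowVol R n _); apply/seteqP; split=> z;
  rewrite /slab_cap/unit_ball/preimage/= dotmul_orthogonal// sE.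
Qed.

(** By invariance the axis is the first basis vector. As n >= 2 there is a second one, orthogonal to
    it; half of it satisfies both defining inequalities strictly, so the cap contains a non-empty
    open set. *)
Lemma rowVol_slab_cap_gt0 (R : realType) n (e : R) (x : 'rV[R]_n) :
  (1 < n)%N -> 0 < e -> x != 0 -> (0 < rowVol R n (slab_cap e x))%E.
Proof.
move=> n1 e0 x0; pose i0 := Ordinal (ltnW n1); pose i1 := Ordinal n1.
pose u i : 'rV[R]_n := delta_mx 0 i.
have uE i j : dotmul (u i) (u j) = (i == j)%:R.
  rewrite /dotmul (bigD1 i)//= big1 ?addr0 => [|k /negPf ki].
    by rewrite !mxE !eqxx/= mul1r.
  by rewrite !mxE ki andbF mul0r.
have u0 : u i0 != 0 by rewrite -dotmul_gt0 uE eqxx.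
rewrite (rowVol_slab_cap e x0 u0).
pose f (z : 'rV[R]_n) : R :=
  e * dotmul z z * dotmul (u i0) (u i0) - dotmul z (u i0) ^+ 2.
pose U := [set z : 'rV[R]_n | 0 < 1 - dotmul z z] `&` [set z | 0 < f z].
have cid : continuous (fun z : 'rV[R]_n => z) by move=> z.
have cu : continuous (fun z : 'rV[R]_n => u i0) by exact: cst_continuous.
have openP (g : 'rV[R]_n -> R) : continuous g -> open [set z | 0 < g z].
  move=> cg; apply: (@open_comp _ _ g [set t | 0 < t]) => [z _|].
    exact: cg.
  exact: open_gt.
have cB (g h : 'rV[R]_n -> R) :
    continuous g -> continuous h -> continuous (fun z => g z - h z).
  by move=> cg ch z; exact: (@continuousB _ R^o _ g h z (cg z) (ch z)).
have cM (g h : 'rV[R]_n -> R) :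
    continuous g -> continuous h -> continuous (fun z => g z * h z).
  by move=> cg ch z; exact: (continuousM (cg z) (ch z)).
have cc (c : R) : continuous (fun _ : 'rV[R]_n => c) by exact: cst_continuous.
have oU : open U.
  apply: openI; apply: openP.
    by apply: cB; [exact: cc|exact: continuous_dotmul].
  apply: (cB _ (fun z => dotmul z (u i0) * dotmul z (u i0))).
    apply: (cM (fun z => e * dotmul z z)); last exact: continuous_dotmul.
    by apply: (cM (fun=> e)); [exact: cc|exact: continuous_dotmul].
  by apply: cM; exact: continuous_dotmul.
have U0 : U !=set0.
  exists (2^-1 *: u i1); rewrite /U/f/= !(dotmulZl, dotmulZr) !uE !eqxx /=.
  by split; nra.
apply: lt_le_trans (open_rowVol_gt0 oU U0) _.
apply: le_measure; rewrite ?inE.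
- exact: sub_sigma_algebra.
- exact: measurable_slab_cap.
- by move=> z [/=]; rewrite !subr_gt0 => /ltW z1 fz; split.
Qed.

(** * Star bodies near a hyperplane *)

(** Since [|x|] is the sup norm, this bound and the next one compare it with the Euclidean norm. *)
Lemma dotmul_self_le (R : realType) n (x : 'rV[R]_n) :
  dotmul x x <= n%:R * `|x| ^+ 2.
Proof.
apply: (@le_trans _ _ (\sum_(i < n) `|x| ^+ 2)); last first.
  by rewrite sumr_const card_ord mulr_natl.
apply: ler_sum => i _; rewrite -expr2 -real_normK ?num_real//.
rewrite ler_pXn2r ?nnegrE// [leRHS]/Num.norm /= mx_normrE.
exact: (le_bigmax _ (fun ij : 'I_1 * 'I_n => `|x ij.1 ij.2|) (0, i)).
Qed.

Lemma norm_sqr_le_dotmul (R : realType) n (x : 'rV[R]_n) :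
  `|x| ^+ 2 <= dotmul x x.
Proof.
have [x0|/mx_norm_neq0[[j i]]] := eqVneq `|x| 0.
  by rewrite x0 expr0n dotmul_ge0.
rewrite (ord1 j) /= => xi; rewrite [X in X ^+ 2]xi real_normK ?num_real//.
exact: sqr_coord_le.
Qed.

Lemma star_body0 (R : realType) n (K : set 'rV[R]_n) : star_body K -> K 0.
Proof.
move=> [[_ [x Kx] KE] sK _].
have {}Kx : K x by rewrite KE; apply: subset_closure.
by have := sK x 0 Kx; rewrite scaler0 add0r scale0r; apply; rewrite lexx ler01.
Qed.

Lemma le_radial (R : realType) n (K : set 'rV[R]_n) (c : R) (x : 'rV[R]_n) :
  compact K -> x != 0 -> K (c *: x) -> c <= radial_function K x.
Proof.
move=> /compact_bounded[M [_ KM]] x0 Kcx; apply: ub_le_sup => //.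
exists ((M + 1) / `|x|) => d /= Kdx.
rewrite ler_pdivlMr ?normr_gt0//.
apply: le_trans (KM (M + 1) _ _ Kdx); last by rewrite ltrDl.
by rewrite normrZ ler_wpM2r// ler_norm.
Qed.

(** Strictness gives some d > c with [d *: x] in [K], which star-shapedness shrinks to [c *: x]. *)
Lemma lt_radial (R : realType) n (K : set 'rV[R]_n) (c : R) (x : 'rV[R]_n) :
  K 0 -> star_shaped_at K 0 -> 0 <= c -> c < radial_function K x -> K (c *: x).
Proof.
move=> K0 sK c0 /sup_gt[|d /= Kdx cd].
  by exists 0; rewrite /= scale0r.
have d0 : 0 < d by exact: le_lt_trans cd.
have := sK _ (c / d) Kdx; rewrite scaler0 add0r scalerA divfK ?gt_eqF//; apply.
by rewrite divr_ge0 ?(ltW d0)//= ler_pdivrMr// mul1r ltW.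
Qed.

Lemma compact_sphere (R : realType) n :
  compact [set x : 'rV[R]_n | dotmul x x = 1].
Proof.
apply: bounded_closed_compact.
  exists 1; split => // M M1 x /= x1.
  apply: le_trans (ltW M1); rewrite -(@ler_pXn2r _ 2) ?nnegrE// expr1n -x1.
  exact: norm_sqr_le_dotmul.
apply: (@closed_comp _ _ (fun x : 'rV[R]_n => dotmul x x) [set t | t = 1]).
  have cid : continuous (fun x : 'rV[R]_n => x) by move=> x.
  by move=> x _; exact: (continuous_dotmul cid cid).
exact: closed_eq.
Qed.

(** Only [x] is confined to the compact sphere: [y] will be the projection of a unit vector to a
    hyperplane, which may be shorter than 1. *)
Lemma radial_unif_continuous (R : realType) n (K : set 'rV[R]_n) (d : R) :
  {within [set x : 'rV[R]_n | x != 0], continuous (radial_function K)} -> 0 < d ->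
  exists2 r, 0 < r & forall x y : 'rV[R]_n, dotmul x x = 1 -> `|x - y| < r ->
    y != 0 /\ `|radial_function K x - radial_function K y| < d.
Proof.
move=> cK d0.
have opn : open [set x : 'rV[R]_n | x != 0].
  rewrite (_ : [set _ | _] = ~` [set 0]).
    by apply: closed_openC; apply: accessible_closed_set1;
      apply: hausdorff_accessible; exact: norm_hausdorff.
  by apply/seteqP; split=> x /= /eqP.
rewrite (continuous_open_subspace _ opn) in cK.
pose P (r : R) (x : 'rV[R]_n) := forall y : 'rV[R]_n, `|x - y| < r ->
    y != 0 /\ `|radial_function K x - radial_function K y| < d.
have : \forall r \near 0^'+, [set x : 'rV[R]_n | dotmul x x = 1] `<=` P r.
  apply: (proj1 (compact_near_coveringP _) (@compact_sphere R n)) => x /= x1.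
  have x0 : x != 0 by rewrite -dotmul_gt0 x1.
  have ctx : {for x, continuous (radial_function K)} by apply: cK; rewrite inE.
  have d20 : 0 < d / 2 by rewrite divr_gt0.
  have nx : nbhs x [set y : 'rV[R]_n | y != 0] by exact: open_nbhs_nbhs.
  have ny : nbhs x [set y | `|radial_function K x - radial_function K y| < d / 2].
    by move/(@cvgrPdist_lt R R^o) : ctx; apply.
  have : nbhs x ([set y | y != 0] `&`
      [set y | `|radial_function K x - radial_function K y| < d / 2]).
    exact: filterI.
  move=> /nbhs_ballP[q /= q0 qP].
  have q20 : 0 < q / 2 by rewrite divr_gt0.
  (* If x' is within q/2 of x and y within q/2 of x', both lie in the ball of radius [q] about x. *)
  exists (ball x (q / 2), [set r | r < q / 2]); rewrite /=.
    by split; [exact: nbhsx_ballx|exact: nbhs_right_lt].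
  move=> [x' r] [/=]; rewrite -!ball_normE /ball_/= => xx' rq y x'y.
  have xy : `|x - y| < q.
    rewrite -(subrK x' x) -addrA (le_lt_trans (ler_normD _ _))//.
    by have := lt_trans x'y rq; move: xx'; lra.
  have xx'q : `|x - x'| < q by move: xx' q0; lra.
  have [] := qP y _; first by rewrite -ball_normE.
  have [] := qP x' _; first by rewrite -ball_normE.
  move=> _ /= x'd y0 yd; split => //.
  rewrite (le_lt_trans (ler_distD (radial_function K x) _ _))//.
  by rewrite (distrC (radial_function K x')); move: x'd yd; lra.
move=> H; have [r [r0 rP]] := filter_ex (filterI (nbhs_right_gt 0) H).
by exists r => // x y x1; exact: rP.
Qed.

(** Write x = c th with th a unit vector and let p be the projection of th to the hyperplane. In a
    thin slab p is close to th, so the radial function at p exceeds c - s, and (c - s) p is a point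
    of the section close to x. *)
Lemma star_body_near_section (R : realType) n (K : set 'rV[R]_n) (d : R) :
  star_body K -> 0 < d ->
  exists2 e, 0 < e & forall xi x : 'rV[R]_n, K x -> slab e xi x ->
    exists u, [/\ K u, dotmul u xi = 0 & dotmul (x - u) (x - u) < d].
Proof.
move=> sbK d0; have K0 := star_body0 sbK.
case: sbK => [[cK _ _] sK ctK].
have [M M0 KM] : exists2 M, 0 < M & forall x, K x -> dotmul x x <= M.
  have [N [_ KN]] := compact_bounded cK.
  exists (n%:R * (`|N| + 1) ^+ 2 + 1).
    by rewrite ltr_wpDl// mulr_ge0// sqr_ge0.
  move=> x Kx; apply: le_trans (dotmul_self_le _) _.
  rewrite ler_wpDr// ler_wpM2l// ler_pXn2r ?nnegrE ?addr_ge0//.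
  by apply: KN Kx; rewrite ltr_pwDr// ler_norm.
(* The final bound is 2 (M e + s^2) <= d/2 + 2d/25 < d. *)
pose s := Num.sqrt d / 5.
have s0 : 0 < s by rewrite divr_gt0// sqrtr_gt0.
have sE : 25 * s ^+ 2 = d.
  by rewrite /s expr_div_n sqr_sqrtr ?(ltW d0)//; field.
have [r r0 rK] := radial_unif_continuous ctK s0.
(* The first bound puts p within [r] of th; the second gives M e <= d/4. *)
pose e := Num.min (r ^+ 2) (d / (4 * M)).
have e0 : 0 < e by rewrite lt_min exprn_gt0//= divr_gt0// mulr_gt0.
exists e => // xi x Kx sl.
have xi0 : 0 < dotmul xi xi by rewrite dotmul_gt0; exact: slab_neq0l sl.
have x0 : 0 < dotmul x x.
  by rewrite dotmul_gt0; move: sl; rewrite slabC => /slab_neq0l.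
pose c := Num.sqrt (dotmul x x).
have c0 : 0 < c by rewrite sqrtr_gt0.
have cE : c ^+ 2 = dotmul x x by rewrite sqr_sqrtr// (ltW x0).
pose th := c^-1 *: x.
have xE : x = c *: th by rewrite scalerA divff ?gt_eqF// scale1r.
have th1 : dotmul th th = 1.
  by rewrite dotmulZl dotmulZr -cE; field; rewrite gt_eqF.
pose a := dotmul th xi / dotmul xi xi.
have [p pE] : {p | p = th - a *: xi} by exists (th - a *: xi).
have axi : dotmul (a *: xi) (a *: xi) < e.
  have : slab e xi th by rewrite slabZr// invr_eq0 gt_eqF.
  rewrite /slab th1 mulr1 dotmulC -ltr_pdivrMr//.
  congr (_ < _); rewrite dotmulZl dotmulZr /a; field; rewrite gt_eqF//.
have pxi : dotmul p xi = 0.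
  by rewrite pE dotmulDl dotmulNl dotmulZl /a divfK ?gt_eqF// subrr.
have pp : dotmul p p <= 1.
  have : dotmul th th = dotmul p p + dotmul (a *: xi) (a *: xi).
    rewrite -[th](subrK (a *: xi)) -pE.
    rewrite !(dotmulDl, dotmulDr) !dotmulZr !dotmulZl (dotmulC xi p) pxi.
    by rewrite !mulr0 addr0 add0r.
  by rewrite th1 => ->; rewrite lerDl dotmul_ge0.
have [p0 rp] : p != 0 /\ `|radial_function K th - radial_function K p| < s.
  apply: rK => //; rewrite pE opprB addrC subrK.
  rewrite -(@ltr_pXn2r _ 2) ?nnegrE ?(ltW r0)//.
  apply: le_lt_trans (norm_sqr_le_dotmul _) (lt_le_trans axi _).
  by rewrite ge_min lexx.
have th0 : th != 0 by rewrite -dotmul_gt0 th1.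
have cth : c <= radial_function K th by apply: le_radial => //; rewrite -xE.
have {}rp : c - s < radial_function K p.
  by move: rp; rewrite ltr_norml => /andP[_]; lra.
(* If c <= s, the origin is already close enough to x and serves as the point. *)
have [c' [c'0 c'c Kc']] : exists c', [/\ 0 <= c', c - s <= c' <= c & K (c' *: p)].
  have [cs|sc] := leP c s.
    by exists 0; rewrite lexx scale0r subr_le0 cs ltW.
  exists (c - s); split; [by rewrite subr_ge0 ltW|by rewrite lexx gerBl ltW|].
  by apply: lt_radial => //; rewrite subr_ge0 ltW.
exists (c' *: p); split => //; first by rewrite dotmulZl pxi mulr0.
(* The first term is small because x is in the slab, the second because c - c' <= s and |p| <= 1. *)
have -> : x - c' *: p = c *: (a *: xi) + (c - c') *: p.
  have thE : th = a *: xi + p by rewrite pE addrC subrK.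
  by rewrite {1}xE {1}thE scalerDr scalerBl addrA.
set v := c *: _; set w := _ *: p.
have par : dotmul (v + w) (v + w) <= 2 * (dotmul v v + dotmul w w).
  have := dotmul_ge0 (v - w).
  rewrite !(dotmulDl, dotmulDr, dotmulNl, dotmulNr) (dotmulC w v); lra.
apply: le_lt_trans par _.
have vv : dotmul v v <= M * e.
  rewrite dotmulZl dotmulZr mulrA -expr2 cE.
  by apply: ler_pM; rewrite ?dotmul_ge0 ?KM// ltW.
have ww : dotmul w w <= s ^+ 2.
  rewrite dotmulZl dotmulZr mulrA -expr2 -[leRHS]mulr1.
  apply: ler_pM; rewrite ?dotmul_ge0 ?sqr_ge0//.
  case/andP: c'c => c1 c2.
  by rewrite ler_pXn2r ?nnegrE ?subr_ge0 ?(ltW s0)//; lra.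
have Me : M * e <= d / 4.
  apply: (@le_trans _ _ (M * (d / (4 * M)))).
    by rewrite ler_pM2l// ge_min lexx orbT.
  by rewrite le_eqVlt; apply/orP; left; apply/eqP; field; rewrite gt_eqF.
lra.
Qed.

(** * Comparison of volumes *)

Lemma closed_measurable_row (R : realType) n (A : set 'rV[R]_n) :
  closed A -> measurable (A : set (borelRow R n)).
Proof.
move=> clA; rewrite -[X in measurable X]setCK; apply: measurableC.
by apply: sub_sigma_algebra; exact: closed_openC.
Qed.

Lemma measurable_row0 (R : realType) n :
  measurable ([set (0 : 'rV[R]_n)] : set (borelRow R n)).
Proof.
apply: closed_measurable_row; apply: accessible_closed_set1.
apply: hausdorff_accessible; exact: norm_hausdorff.
Qed.

(** Here [d] bounds the squared distance. *)
Definition euclid_nbhd (R : realType) n (L : set 'rV[R]_n) (d : R) :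
    set (borelRow R n) :=
  [set x : 'rV[R]_n | exists2 u, L u & dotmul (x - u) (x - u) < d].

Lemma measurable_euclid_nbhd (R : realType) n (L : set 'rV[R]_n) (d : R) :
  measurable (euclid_nbhd L d).
Proof.
apply: sub_sigma_algebra; change (open (euclid_nbhd L d : set 'rV[R]_n)).
have -> : (euclid_nbhd L d : set 'rV[R]_n) =
    \bigcup_(u in L) [set x | dotmul (x - u) (x - u) < d].
  by apply/seteqP; split=> x [u Lu xu]; exists u.
apply: bigcup_open => u Lu.
apply: (@open_comp _ _ (fun x : 'rV[R]_n => dotmul (x - u) (x - u) : R)
    [set t : R | t < d]).
  move=> x _; have cB : continuous (fun x : 'rV[R]_n => x - u).
    move=> y; apply: (@continuousB _ _ _ (fun z => z) (cst u)) => //.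
    exact: cst_continuous.
  exact: (continuous_dotmul cB cB).
exact: open_lt.
Qed.

Lemma bigcap_euclid_nbhd (R : realType) n (L : set 'rV[R]_n) : closed L ->
  \bigcap_k euclid_nbhd L k.+1%:R^-1 = L.
Proof.
move=> clL; apply/seteqP; split=> [x xL|x Lx k _]; last first.
  exists x => //; rewrite subrr (_ : dotmul _ _ = 0) ?invr_gt0//.
  by rewrite /dotmul big1// => i _; rewrite mxE mul0r.
apply: clL => U /nbhs_ballP[r /= r0 rU].
have r20 : 0 < r ^+ 2 by rewrite exprn_gt0.
have [u Lu xu] := xL (Num.truncn (r ^+ 2)^-1) Logic.I.
exists u; split => //; apply: rU; rewrite -ball_normE /ball_/=.
rewrite -(@ltr_pXn2r _ 2) ?nnegrE ?(ltW r0)//.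
apply: le_lt_trans (norm_sqr_le_dotmul _) (lt_trans xu _).
rewrite -[ltRHS]invrK ltf_pV2 ?posrE ?invr_gt0//.
exact: truncnS_gt.
Qed.

Lemma rowVol_euclid_nbhd_lty (R : realType) n (L : set 'rV[R]_n) (d : R) :
  compact L -> (rowVol R n (euclid_nbhd L d) < +oo)%E.
Proof.
move=> /compact_bounded[M [_ LM]].
(* The first two terms bound the norm on [L], the rest the distance to [L]. *)
pose r := `|M| + 1 + (Num.sqrt d + 1).
have r0 : 0 < r by rewrite addr_gt0// ltr_wpDl// sqrtr_ge0.
have /andP[_] := rowVol_ball (0 : 'rV[R]_n) r0.
apply: le_lt_trans; apply: le_measure; rewrite ?inE.
- exact: measurable_euclid_nbhd.
- by apply: sub_sigma_algebra; exact: ball_open.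
move=> x [u Lu xu]; change (ball (0 : 'rV[R]_n) r x).
rewrite -ball_normE /ball_/= sub0r normrN -(subrK u x) addrC.
apply: le_lt_trans (ler_normD _ _) _; apply: ler_ltD.
  by apply: LM Lu; rewrite ltr_pwDr// ler_norm.
rewrite ltr_pwDr// -(@ler_pXn2r _ 2) ?nnegrE ?sqrtr_ge0//.
have d0 : 0 <= d by apply: le_trans (dotmul_ge0 _) (ltW xu).
by rewrite sqr_sqrtr// (le_trans (norm_sqr_le_dotmul _))// ltW.
Qed.

(** The section at xi in the ball is the part of [S] in the slab of xi; the section at x in [S] is
    [slab_cap e x]. *)
Definition slab_pairs (R : realType) n (e : R) (S : set 'rV[R]_n) :
    set (borelRow R n * borelRow R n) :=
  [set p | [/\ unit_ball p.1, slab e (p.1 : 'rV[R]_n) p.2 & S p.2]].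

Lemma measurable_slab_pairs (R : realType) n (e : R) (S : set (borelRow R n)) :
  measurable S -> measurable (slab_pairs e S).
Proof.
move=> mS.
have -> : slab_pairs e S = (unit_ball (n:=n) `*` S) `&`
    [set p | slab e (p.1 : 'rV[R]_n) p.2].
  by apply/seteqP; split=> p; rewrite /slab_pairs/= => -[]; [move=> ? ? ?|case].
apply: measurableI.
  by apply: measurableX => //; exact: measurable_unit_ball.
exact: measurable_slab.
Qed.

(** After exchanging the integrals, each nonzero x in [S] contributes the same cap measure, while x
    = 0 lies in no slab and contributes nothing. *)
Lemma integral_slab_pairs (R : realType) n (e : R) (S : set (borelRow R n))
    (x0 : 'rV[R]_n) : x0 != 0 -> measurable S ->
  (\int[rowVol R n]_xi rowVol R n (xsection (slab_pairs e S) xi) =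
   rowVol R n (slab_cap e x0) * rowVol R n (S `\ (0%R : 'rV[R]_n)))%E.
Proof.
move=> x00 mS; rewrite integral_sections; last exact: measurable_slab_pairs.
have cap (x : 'rV[R]_n) : S x ->
    ysection (slab_pairs e S) (x : borelRow R n) = slab_cap e x.
  move=> Sx; apply/seteqP; split=> y; rewrite /ysection/slab_pairs/= inE/=.
    by case.
  by case.
apply: integral_if_cst => [|//|x [Sx /eqP x0']|x Sx].
- by apply: measurableD => //; exact: measurable_row0.
- by rewrite cap//; exact: rowVol_slab_cap.
- rewrite (_ : ysection _ _ = set0) ?measure0//.
  apply/seteqP; split=> // y; rewrite /ysection/slab_pairs/= inE/= => -[_ yx Sx'].
  apply: Sx; split => //= x0'; move: yx; rewrite slabC => /slab_neq0l.
  by rewrite x0' eqxx.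
Qed.

Lemma star_body_vol_le_nbhd (R : realType) n (K L : set 'rV[R]_n) (d : R) :
  (1 < n)%N -> star_body K ->
  (forall xi : 'rV[R]_n, unit_sphere xi ->
     exists Phi : 'M[R]_n, SO_perp xi Phi /\
       [set x *m Phi | x in K `&` perp xi] `<=` L `&` perp xi) ->
  0 < d -> (rowVol R n K <= rowVol R n (euclid_nbhd L d))%E.
Proof.
move=> n1 sbK KL d0.
have mK : measurable (K : set (borelRow R n)).
  apply: closed_measurable_row; case: sbK => -[cK _ _] _ _.
  by apply: compact_closed => //; exact: norm_hausdorff.
pose N := euclid_nbhd L d; have mN : measurable N by exact: measurable_euclid_nbhd.
have [e e0 eK] := star_body_near_section sbK d0.
pose x0 : 'rV[R]_n := delta_mx 0 (Ordinal n1).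
have x00 : x0 != 0.
  apply/eqP => /rowP /(_ (Ordinal n1)); rewrite !mxE !eqxx /=.
  by apply/eqP; rewrite oner_eq0.
pose C := rowVol R n (slab_cap e x0).
have C0 : (0 < C)%E by exact: rowVol_slab_cap_gt0.
have Cfin : C \is a fin_num.
  rewrite ge0_fin_numE ?measure_ge0//; apply: le_lt_trans (@unit_ball_lty R n).
  apply: le_measure; rewrite ?inE; first exact: measurable_slab_cap.
    exact: measurable_unit_ball.
  by move=> x [].
(* The rotation given for the normalised xi fixes xi, hence its slab, and preserves volume; it maps
   the section for [K] into the one for [N]. *)
have le_sec (xi : borelRow R n) :
    (rowVol R n (xsection (slab_pairs e K) xi) <=
     rowVol R n (xsection (slab_pairs e N) xi))%E.
  have [->|xi0] := eqVneq (xi : 'rV[R]_n) 0.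
    rewrite (_ : xsection (slab_pairs e K) _ = set0) ?measure0//.
    apply/seteqP; split=> // x; rewrite /xsection/slab_pairs/= inE/=.
    by move=> -[_ /slab_neq0l /eqP].
  pose c := Num.sqrt (dotmul (xi : 'rV[R]_n) xi).
  have c0 : 0 < c by rewrite sqrtr_gt0 dotmul_gt0.
  have cV0 : c^-1 != 0 by rewrite invr_eq0 gt_eqF.
  pose th : 'rV[R]_n := c^-1 *: (xi : 'rV[R]_n).
  have th1 : unit_sphere th.
    rewrite /unit_sphere/= dotmulZl dotmulZr mulrA sqrtrM; last first.
      by rewrite mulr_ge0// invr_ge0 ltW.
    by rewrite -expr2 sqrtr_sqr ger0_norm ?invr_ge0 ?(ltW c0)// mulVf ?gt_eqF.
  have [Phi [[[PhiT _] thPhi] PhiL]] := KL th th1.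
  have xiPhi : (xi : 'rV[R]_n) *m Phi = xi.
    apply: (scalerI cV0); rewrite -[RHS]thPhi /th.
    by rewrite scalemxAl.
  rewrite -[X in (_ <= X)%E](rowVol_orthogonal PhiT); last first.
    by apply: measurable_xsection; exact: measurable_slab_pairs.
  apply: le_measure; rewrite ?inE.
  - by apply: measurable_xsection; exact: measurable_slab_pairs.
  - rewrite -[X in measurable X]setTI.
    have mPhi : measurable_fun setT (fun x : borelRow R n =>
        (x : 'rV[R]_n) *m Phi : borelRow R n) by exact: measurable_mulmx.
    apply: mPhi => //.
    by apply: measurable_xsection; exact: measurable_slab_pairs.
  move=> x; rewrite /xsection/slab_pairs/preimage/= !inE/= => -[xiB xix Kx].
  split => //; first by rewrite -xiPhi slab_orthogonal.
  (* The image of [u] lies in [L] and is as close to the image of x as [u] is to x. *)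
  have [u [Ku uxi xu]] := eK _ _ Kx xix.
  exists (u *m Phi).
    suff : (L `&` perp th) (u *m Phi) by case.
    apply: PhiL; exists u => //; split => //.
    by rewrite /perp/= dotmulZr uxi mulr0.
  by rewrite -mulmxBl dotmul_orthogonal.
have K0E : rowVol R n (K `\ (0 : 'rV[R]_n)) = rowVol R n K.
  have m0 : measurable ([set (0 : 'rV[R]_n)] : set (borelRow R n)).
    exact: measurable_row0.
  rewrite -(@measureU0 _ _ _ (rowVol R n) (K `\ (0 : 'rV[R]_n)) [set 0])//.
  - congr (rowVol R n _); apply/seteqP; split=> x /=.
      by move=> [[]|->//]; last exact: star_body0.
    by move=> Kx; have [->|/eqP x0'] := eqVneq (x : 'rV[R]_n) 0; [right|left].
  - exact: measurableD.
  - by apply: rowVol_set0; exact: ltnW.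
rewrite -K0E; apply: (@le_trans _ _ (rowVol R n (N `\ (0 : 'rV[R]_n)))); last first.
  apply: le_measure; rewrite ?inE; [|by []|by move=> x []].
  by apply: measurableD => //; exact: measurable_row0.
(* Multiplying by the positive finite constant [C] turns both volumes into integrals of sections. *)
rewrite -(lee_pmul2l Cfin C0) -!integral_slab_pairs//.
apply: ge0_le_integral => //.
- by apply: measurable_fun_xsection; exact: measurable_slab_pairs.
- by apply: measurable_fun_xsection; exact: measurable_slab_pairs.
Qed.

Theorem theorem1 (R : realType) (n : nat) (hn : (2 <= n)%N)
    (K L : set 'rV[R]_n) (hK : star_body K) (hL : star_body L)
    (hKL : forall xi : 'rV[R]_n, unit_sphere xi ->
       exists Phi : 'M[R]_n, SO_perp xi Phi /\
         [set x *m Phi | x in K `&` perp xi] `<=` L `&` perp xi) :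
  (vol K <= vol L)%E.
Proof.
rewrite -rowVolE.
have cL : compact L by case: hL => -[].
have clL : closed L by apply: compact_closed => //; exact: norm_hausdorff.
rewrite -(bigcap_euclid_nbhd clL).
(* Continuity from above along the shrinking neighbourhoods of [L], the first of which has finite
   volume because [L] is bounded. *)
have cvg := @nonincreasing_cvg_mu _ _ _ (rowVol R n)
  (fun k => euclid_nbhd L k.+1%:R^-1) (rowVol_euclid_nbhd_lty _ cL)
  (fun k => measurable_euclid_nbhd L _).
apply: (cvge_to_ge (cvg _ _)).
- by apply: bigcapT_measurable => k; exact: measurable_euclid_nbhd.
- move=> i j ij; apply/subsetPset => x [u Lu xu]; exists u => //.
  by apply: lt_le_trans xu _; rewrite lef_pV2 ?posrE// ler_nat.
- by apply: nearW => k; apply: star_body_vol_le_nbhd => //; rewrite invr_gt0.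
Qed.
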